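(* Let $n\in\mathbb{N}$, and let $\rho\ge 1/2$ and $\lambda\le 1/33$ be constants. Let $G=(V,E)$ be a (regular) test graph with $V\subseteq\mathcal{P}([n])$, let $\varepsilon\ge 0$, and let $F\in\mathcal{F}_V$. Suppose $G$ is a $(\lambda,\rho)$-coordinate expander. If $F$ passes the test $\mathcal{T}(G)$ with probability $1-\varepsilon$, then $F$ is $(1-O(\varepsilon))$-close to $\mathrm{dec}(F)$, i.e. $\Delta(F,\mathrm{dec}(F))=O(\varepsilon)$, where the constant in the $O(\cdot)$ is absolute (independent of $n$, $|V|$, $G$ and $F$).
   Context: For a set $S\subseteq[n]$, a function on $S$ is an element of $\{0,1\}^S$. For $V\subseteq\mathcal{P}([n])$, $\mathcal{F}_V$ is the set of all maps $F$ assigning to each $S\in V$ a function $F(S)\in\{0,1\}^S$. For $a\in\{0,1\}^n$, the direct product encoding $\mathrm{DP}_V(a)\in\mathcal{F}_V$ is given by $\mathrm{DP}_V(a)(S)=a|_S$. For $F,H\in\mathcal{F}_V$, $\Delta(F,H)=|\{S\in V: F(S)\neq H(S)\}|/|V|$; $F$ is $(1-\delta)$-close to $H$ if $\Delta(F,H)\le\delta$. For $F\in\mathcal{F}_V$, define $a^F\in\{0,1\}^n$ by letting $a^F_i$ be the majority value of $F(S)_i$ over all $S\in V$ with $i\in S$, and $\mathrm{dec}(F)=\mathrm{DP}_V(a^F)$. A test graph is a regular graph $G$ on vertex set $V$ (self-loops and multiple edges allowed); the test $\mathcal{T}(G)$ on input $F$ picks an edge $(S,S')$ of $G$ uniformly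 at random and accepts iff $F(S)|_{S\cap S'}=F(S')|_{S\cap S'}$. For $i\in[n]$, $V_i=\{S\in V: i\in S\}$ and $G_i$ is the subgraph of $G$ induced on $V_i$. For a graph $H$ with normalized adjacency matrix $A_H$ on $N$ vertices, $\lambda(H)=\max\{|\lambda_2(A_H)|,|\lambda_N(A_H)|\}$. $S'\sim S$ denotes a uniformly random neighbor $S'$ of $S$ in $G$. $G$ is a $(\lambda,\rho)$-coordinate expander if: (1) $\lambda(G)<\lambda$ and $\lambda(G_i)<\lambda$ for every $i\in[n]$; (2) for every $i\in[n]$ and every $S\in V_i$, $\Pr_{S'\sim S}[S'\in V_i]\ge\rho$; (3) for every $S\in V$ and every $T\subseteq S$ with $|T|\ge 2/\rho$, $\Pr_{S'\sim S}[|S'\cap T|\le\rho|T|/2]\le\lambda$. *)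

(* Defs.v *)
From HB Require Import structures.
From mathcomp Require Import all_boot all_order all_algebra.
From mathcomp Require Import boolp classical_sets reals.

Set Implicit Arguments.
Unset Strict Implicit.
Unset Printing Implicit Defensive.

Import Order.TTheory GRing.Theory Num.Theory.
Local Open Scope ring_scope.

(* A finite graph with self-loops and multiple edges is given by its adjacency
   matrix: [mult x y] parallel edges join [x] and [y], and a self-loop at [x]
   contributes to the degree of [x] exactly what it contributes to
   [mult x x]. *)
Record multigraph (T : finType) := Multigraph {
  mult :> T -> T -> nat;
  mult_sym : forall x y, mult x y = mult y x }.

Definition deg (T : finType) (G : multigraph T) (x : T) : nat :=
  (\sum_y G x y)%N.

Definition regular (T : finType) (G : multigraph T) : Prop :=
  exists d : nat, forall x, deg G x = d.

Definition induced (T : finType) (G : multigraph T) (U : {set T}) :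
    multigraph {x : T | x \in U} :=
  Multigraph (fun x y => mult_sym G (val x) (val y)).

(* D^(-1/2) A D^(-1/2); for a regular graph this is A / d.  Induced subgraphs
   of a regular graph need not be regular. *)
Definition norm_adj (R : realType) (T : finType) (G : multigraph T) :
    'M[R]_#|T| :=
  \matrix_(i, j) ((G (enum_val i) (enum_val j))%:R /
    Num.sqrt ((deg G (enum_val i))%:R * (deg G (enum_val j))%:R)).

(* The eigenvalues with algebraic multiplicity, in nonincreasing order.  For a
   real symmetric matrix the list exists and is unique. *)
Definition spectrum (R : realType) (N : nat) (A : 'M[R]_N) : seq R :=
  xget [::] [set s : seq R | sorted (fun x y : R => y <= x) s /\
                             char_poly A = \prod_(x <- s) ('X - x%:P)].

(* A graph on at most one vertex has no second eigenvalue; its [lambda] is 0. *)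
Definition lambda (R : realType) (T : finType) (G : multigraph T) : R :=
  let s := spectrum (norm_adj R G) in
  if (#|T| <= 1)%N then 0 else Num.max `|s`_1| `|s`_(#|T|.-1)|.

(* The probability that a uniformly random neighbour of [x], counted with
   multiplicity, satisfies [P]. *)
Definition nbr_prob (R : realType) (T : finType) (G : multigraph T)
    (x : T) (P : pred T) : R :=
  (\sum_(y | P y) G x y)%N%:R / (deg G x)%:R.

Notation vertex V := {S | S \in V}.

(* {0,1}^S *)
Notation local_fun S := {ffun {i | i \in S} -> bool}.

Definition assignment (n : nat) (V : {set {set 'I_n}}) : Type :=
  forall S : vertex V, local_fun (val S).

Definition DP (n : nat) (V : {set {set 'I_n}}) (a : {ffun 'I_n -> bool}) :
    assignment V :=
  fun S => [ffun x => a (val x)].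

Arguments DP {n} V a.

Definition dist (R : realType) (n : nat) (V : {set {set 'I_n}})
    (F H : assignment V) : R :=
  #|[set S : vertex V | F S != H S]|%:R / #|V|%:R.

Definition votes (n : nat) (V : {set {set 'I_n}}) (F : assignment V)
    (i : 'I_n) (b : bool) : nat :=
  #|[set S : vertex V | [exists x : {j : 'I_n | j \in val S},
                           (val x == i) && (F S x == b)]]|.

(* [tie] is an arbitrary rule for breaking ties. *)
Definition majority (n : nat) (V : {set {set 'I_n}}) (tie : 'I_n -> bool)
    (F : assignment V) : {ffun 'I_n -> bool} :=
  [ffun i => if (votes F i false < votes F i true)%N then true
             else if (votes F i true < votes F i false)%N then false
             else tie i].

Definition dec (n : nat) (V : {set {set 'I_n}}) (tie : 'I_n -> bool)
    (F : assignment V) : assignment V :=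
  DP V (majority tie F).

Definition agree (n : nat) (V : {set {set 'I_n}}) (F : assignment V)
    (S S' : vertex V) : bool :=
  [forall x : {i : 'I_n | i \in val S}, forall y : {i : 'I_n | i \in val S'},
     (val x == val y) ==> (F S x == F S' y)].

(* An edge is sampled as an ordered pair (S, S'), with probability proportional
   to its multiplicity; in a regular graph this is a uniform vertex S followed
   by a uniform neighbour S'. *)
Definition pass_prob (R : realType) (n : nat) (V : {set {set 'I_n}})
    (G : multigraph (vertex V)) (F : assignment V) : R :=
  (\sum_S \sum_(S' | agree F S S') G S S')%N%:R / (\sum_S deg G S)%N%:R.

Definition star (n : nat) (V : {set {set 'I_n}}) (i : 'I_n) :
    {set vertex V} :=
  [set S : vertex V | i \in val S].

Definition coordinate_expander (R : realType) (n : nat)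
    (V : {set {set 'I_n}}) (lam rho : R) (G : multigraph (vertex V)) : Prop :=
  [/\ lambda R G < lam /\
        (forall i : 'I_n, lambda R (induced G (star V i)) < lam),
      forall (i : 'I_n) (S : vertex V), S \in star V i ->
        rho <= nbr_prob R G S (fun S' => S' \in star V i)
    & forall (S : vertex V) (T : {set 'I_n}), T \subset val S ->
        2 / rho <= #|T|%:R ->
        nbr_prob R G S
          (fun S' => #|val S' :&: T|%:R <= rho * #|T|%:R / 2) <= lam].

(* Main.v *)
(* Write D(S) for the set of coordinates where F(S) differs from the majority
   assignment, and for fixed i put f_i(S) = [i in D(S)] / sqrt |D(S)|.  The
   support of f_i is at most half of V_i, so the spectral gap of G_i bounds
   sum G_i(S,S') f_i(S) f_i(S') by 67/99 sum deg_i(S) f_i(S)^2.  Summing over i,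
   for random edges (S,S'),

     E [|D(S) & D(S')| / sqrt (|D(S)| |D(S')|)] <=
       67/99 E [|D(S) & S'| / |D(S)|].

   On an accepted edge both intersections are the same set; when it is nonempty
   and makes up at least a quarter of D(S) and of D(S'), the symmetrised
   inequality fails by a definite amount.  At each S with D(S) nonempty,
   condition (2) makes half of the edges meet D(S), and by condition (3) only a
   fraction 1/33 of them capture less than a quarter of it; hence rejected edges
   must compensate.  The normalisation 1 / sqrt |D(S)| makes every edge
   contribute O(1), whatever the sizes of the sets D(S). *)
Require Import Defs.
From mathcomp Require Import all_boot all_order all_algebra.
From mathcomp Require Import boolp classical_sets reals.
From mathcomp Require Import fintype finset complex ring lra.

Set Implicit Arguments.
Unset Strict Implicit.
Unset Printing Implicit Defensive.

Import Order.TTheory GRing.Theory Num.Theory.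
Local Open Scope ring_scope.

(** * Spectra of real symmetric matrices *)

Lemma char_poly_conj (K : comUnitRingType) (n : nat) (P A : 'M[K]_n) :
  P \in unitmx -> char_poly (invmx P *m A *m P) = char_poly A.
Proof.
move=> Pu; rewrite /char_poly /char_poly_mx.
have PK : map_mx polyC (invmx P) *m map_mx polyC P = 1%:M.
  by rewrite -map_mxM mulVmx // map_mx1.
have -> : 'X%:M - map_mx polyC (invmx P *m A *m P) =
    map_mx polyC (invmx P) *m ('X%:M - map_mx polyC A) *m map_mx polyC P.
  rewrite !map_mxM mulmxBr mulmxBl; congr (_ - _).
  by rewrite scalar_mxC -mulmxA PK mulmx1.
by rewrite !det_mulmx mulrAC -det_mulmx PK det1 mul1r.
Qed.

Local Open Scope sesquilinear_scope.

(** Over [R[i]] the matrix is Hermitian, hence unitarily diagonalizable with real eigenvalues [d].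
    [w v] is the row of coordinates of [v] in an eigenbasis; these may be complex, but the Hermitian
    form on them recovers the real inner product. *)
Lemma symmetric_spectral (R : rcfType) (N : nat) (A : 'M[R]_N) : A^T = A ->
  exists (d : 'I_N -> R) (w : 'rV[R]_N -> 'I_N -> R[i]),
  [/\ char_poly A = \prod_j ('X - (d j)%:P),
      forall u v, real_complex R ((u *m v^T) 0 0) = \sum_j w u j * (w v j)^*
    & forall v j, w (v *m A) j = real_complex R (d j) * w v j].
Proof.
move=> Asym; pose c := real_complex R.
have cJ x : (c x)^* = c x by apply/CrealP; rewrite complex_real.
pose AC := map_mx c A.
have ACh : AC \is hermsymmx.
  apply: realsym_hermsym.
    by apply/is_hermitianmxP; rewrite expr0 scale1r map_mx_id // /AC map_trmx Asym.
  by apply/mxOverP=> i j; rewrite mxE complex_real.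
have /orthomx_spectralP := hermitian_normalmx ACh.
set P := spectralmx AC; set D := spectral_diag AC => ACE.
have Pun : P \is unitarymx by exact: spectral_unitarymx.
have Pu : P \in unitmx by exact: unitarymx_unit.
have Pi : invmx P = P ^t* by exact: invmx_unitary.
have /mxOverP Dr := hermitian_spectral_diag_real ACh.
have DE j : c (complex.Re (D 0 j)) = D 0 j by apply: RRe_real; exact: Dr.
exists (fun j => complex.Re (D 0 j)), (fun v j => (map_mx c v *m P ^t* ) 0 j).
split.
- apply: (@map_poly_inj _ _ c).
  rewrite map_char_poly -/AC ACE char_poly_conj // char_poly_trig; last first.
    by apply: diag_mx_is_trig.
  rewrite rmorph_prod /=; apply: eq_bigr => j _.
  by rewrite rmorphB /= map_polyX map_polyC /= mxE eqxx -DE.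
- move=> u v; rewrite -/(c _).
  have -> : c ((u *m v^T) 0 0) =
      ((map_mx c u *m P^t* ) *m (map_mx c v *m P^t* ) ^t* ) 0 0.
    rewrite trmx_mul map_mxM /= trmxCK.
    rewrite mulmxA -[_ *m P]mulmxA -Pi mulVmx // mulmx1.
    rewrite !mxE /c rmorph_sum; apply: eq_bigr => k _.
    by rewrite !mxE rmorphM /= cJ.
  by rewrite mxE; apply: eq_bigr => k _; rewrite !mxE.
- move=> v j; rewrite -/(c _).
  rewrite map_mxM -/AC ACE -Pi -!mulmxA mulmxV // mulmx1 !mulmxA Pi.
  by rewrite mul_mx_diag mxE DE mulrC.
Qed.

Local Close Scope sesquilinear_scope.

(** Sorting [d] gives a list that meets the specification of [spectrum], so the choice does not fall
    back to its default; linear factors determine a list up to order. *)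
Lemma spectrum_perm (R : realType) (N : nat) (A : 'M[R]_N) (d : 'I_N -> R) :
  char_poly A = \prod_j ('X - (d j)%:P) ->
  sorted >=%R (spectrum A) /\ perm_eq (spectrum A) [seq d j | j <- enum 'I_N].
Proof.
move=> Ad; pose s := sort >=%R [seq d j | j <- enum 'I_N].
have prod_s : char_poly A = \prod_(x <- s) ('X - x%:P).
  rewrite Ad (perm_big [seq d j | j <- enum 'I_N]); last by rewrite perm_sort.
  by rewrite big_map big_enum.
have sorted_s : sorted >=%R s by apply: sort_sorted => x y; exact: le_total.
have [] := @xgetPex _ [::] [set s : seq R | sorted (fun x y : R => y <= x) s /\
   char_poly A = \prod_(x <- s) ('X - x%:P)]%classic.
  by exists s.
rewrite -/(spectrum A) => sorted_spec prod_spec; split=> //.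
apply: (@perm_trans _ s); last by rewrite perm_sort.
by apply: prod_XsubC_eq; rewrite -prod_spec.
Qed.

Lemma count_gt_second (R : realDomainType) (lam : R) (s : seq R) :
  sorted >=%R s -> s`_1 <= lam -> (count (> lam) s <= 1)%N.
Proof.
case: s => [|x [|y s]] //=; first by rewrite addn0 leq_b1.
move=> /andP[_ ys] ylam; rewrite [(lam < y)%R]ltNge ylam add0n.
rewrite (@eq_in_count _ _ pred0) ?count_pred0 ?addn0 ?leq_b1 // => z zs.
apply/negbTE; rewrite -leNgt (le_trans _ ylam) //.
have ge_trans : transitive (>=%R : rel R) by move=> a b c /[swap]; exact: le_trans.
by move: ys; rewrite (path_sortedE ge_trans) => /andP[/allP/(_ _ zs)].
Qed.

(** Split [v] into a multiple of [e], where the eigenvalue is 1, and a part orthogonal to [e], where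
    all eigenvalues are at most [lam]. Multiplying by the squared norm of [e] avoids a division. *)
Lemma second_eigenvalue_form (R : realType) (N : nat) (A : 'M[R]_N)
    (e v : 'rV[R]_N) (lam : R) :
  A^T = A -> e *m A = e -> e != 0 -> lam < 1 -> (spectrum A)`_1 <= lam ->
  (v *m A *m v^T) 0 0 * (e *m e^T) 0 0 <=
    lam * (v *m v^T) 0 0 * (e *m e^T) 0 0 + (1 - lam) * ((v *m e^T) 0 0) ^+ 2.
Proof.
move=> Asym eA e0 lam1 s1.
have [d [w [Ad dotE wA]]] := symmetric_spectral Asym.
have [s_sorted s_perm] := spectrum_perm Ad.
have d_gt : (#|[pred j | (lam < d j)%R]| <= 1)%N.
  have := count_gt_second s_sorted s1.
  rewrite (permP s_perm) count_map; apply: leq_trans.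
  by rewrite -sum1_count big_enum_cond /= sum1_card; apply: eq_leq; apply: eq_card.
pose c := real_complex R.
have [j0 wej0] : exists j, w e j != 0.
  apply/existsP; apply: contraNT e0; rewrite negb_exists => /forallP we0.
  have : (e *m e^T) 0 0 = 0.
    apply: complexI; rewrite dotE big1 // => j _.
    by have := we0 j; rewrite negbK => /eqP ->; rewrite mul0r.
  rewrite mxE => /eqP; rewrite psumr_eq0 => [/allP e2 | j _]; last first.
    by rewrite mxE -expr2 sqr_ge0.
  apply/eqP/rowP => j; have := e2 j; rewrite mem_index_enum => /(_ isT) /=.
  by rewrite !mxE -expr2 sqrf_eq0 => /eqP.
(* Since [A] fixes [e], the coordinates of [e] are supported at eigenvalue 1, which exceeds [lam];
   by [d_gt] the only such index is [j0]. *)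
have d1 j : w e j != 0 -> d j = 1.
  move=> wej; have := wA e j; rewrite eA -[LHS]mul1r => /(mulIf wej).
  by rewrite -(rmorph1 (real_complex R)) => /complexI ->.
have dle j : j != j0 -> d j <= lam.
  move=> jj0; rewrite leNgt; apply/negP => lamj.
  have /card_le1P/(_ j0) := d_gt; rewrite !inE d1 // => /(_ lam1 j).
  by rewrite !inE lamj (negbTE jj0).
have we0 j : j != j0 -> w e j = 0.
  move=> jj0; apply/eqP/negPn/negP => /d1 dj.
  by have := dle j jj0; rewrite dj leNgt lam1.
have normE (u : 'rV[R]_N) : c ((u *m u^T) 0 0) = \sum_j `|w u j| ^+ 2.
  by rewrite /c dotE; apply: eq_bigr => j _; rewrite normCK.
have eE : c ((e *m e^T) 0 0) = `|w e j0| ^+ 2.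
  by rewrite normE (bigD1 j0) //= big1 ?addr0 // => j /we0->; rewrite normr0 expr0n.
have veE : c ((v *m e^T) 0 0) * c ((v *m e^T) 0 0) = `|w v j0| ^+ 2 * `|w e j0| ^+ 2.
  have veE : c ((v *m e^T) 0 0) = w v j0 * (w e j0)^*.
    by rewrite /c dotE (bigD1 j0) //= big1 ?addr0 // => j /we0->; rewrite conjC0 mulr0.
  have ver : c ((v *m e^T) 0 0) \is Num.real by rewrite complex_real.
  rewrite -expr2 -(real_normK ver) veE normrM exprMn.
  by rewrite norm_conjC.
have vAv : c ((v *m A *m v^T) 0 0) = \sum_j c (d j) * `|w v j| ^+ 2.
  by rewrite /c dotE; apply: eq_bigr => j _; rewrite wA normCK mulrA.
rewrite -lecR rmorphD !rmorphM /= -/c vAv eE veE normE.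
rewrite [X in _ + X]mulrA -mulrDl ler_wpM2r ?exprn_ge0 //.
(* At [j0] both sides agree because [1 = lam + (1 - lam)]; the other terms are compared one by
   one. *)
rewrite mulr_sumr (bigD1 j0) //= [X in _ <= X + _](bigD1 j0) //=.
rewrite [leRHS]addrAC -mulrDl -(rmorphD c) d1 // [lam + _]addrC subrK lerD2l.
apply: ler_sum => j /dle dj; rewrite ler_wpM2r ?exprn_ge0 //.
by rewrite /c lecR.
Qed.

(** * Quadratic forms of graphs *)

(** Lagrange's identity: twice the difference of the two sides is the double sum of
    [a x * a y * (g x - g y) ^+ 2]. *)
Lemma weighted_Cauchy_Schwarz (R : realDomainType) (T : finType) (P : pred T)
    (a g : T -> R) : (forall x, 0 <= a x) ->
  (\sum_(x | P x) a x * g x) ^+ 2 <=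
    (\sum_(x | P x) a x) * \sum_(x | P x) a x * g x ^+ 2.
Proof.
move=> a0; rewrite -subr_ge0 -(@pmulr_rge0 _ 2) //.
suff -> : 2 * ((\sum_(x | P x) a x) * (\sum_(x | P x) a x * g x ^+ 2) -
      (\sum_(x | P x) a x * g x) ^+ 2) =
    \sum_(x | P x) \sum_(y | P y) a x * a y * (g x - g y) ^+ 2.
  by do 2![apply: sumr_ge0 => ? _]; rewrite mulr_ge0 ?sqr_ge0 // mulr_ge0.
have sqE : \sum_(x | P x) \sum_(y | P y) a x * a y * (g x - g y) ^+ 2 =
    \sum_(x | P x) \sum_(y | P y) (a x * g x ^+ 2) * a y +
    \sum_(x | P x) \sum_(y | P y) a x * (a y * g y ^+ 2) -
    2 * \sum_(x | P x) \sum_(y | P y) (a x * g x) * (a y * g y).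
  rewrite mulr_sumr -big_split -sumrB /=; apply: eq_bigr => x _.
  rewrite mulr_sumr -big_split -sumrB /=; apply: eq_bigr => y _.
  ring.
by rewrite sqE -!big_distrlr /=; ring.
Qed.

(** On at most one vertex the list has no entry of index 1, and the default 0 of [nth] equals the
    value given to [lambda]. *)
Lemma spectrum_second_le_lambda (R : realType) (T : finType)
    (G : multigraph T) :
  (spectrum (norm_adj R G))`_1 <= lambda R G.
Proof.
rewrite /lambda; case: leqP => [T1 | _]; last by rewrite le_max ler_norm.
have sym : (norm_adj R G)^T = norm_adj R G.
  by apply/matrixP => i j; rewrite !mxE mult_sym [X in Num.sqrt X]mulrC.
have [d [w [Ad _ _]]] := symmetric_spectral sym.
have [_ s_perm] := spectrum_perm Ad.
by rewrite nth_default // (perm_size s_perm) size_map size_enum_ord.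
Qed.

(** The vector of square roots of the degrees is fixed by the normalized adjacency matrix, even if
    the graph is not regular. Scaling [g] by these roots turns [second_eigenvalue_form] into an
    inequality between degree-weighted sums. *)
Lemma mixing_form (R : realType) (T : finType) (G : multigraph T) (g : T -> R)
    (lam : R) :
  (forall x, 0 < deg G x)%N -> lambda R G <= lam -> lam < 1 ->
  (\sum_x \sum_y (G x y)%:R * (g x * g y)) * (\sum_x (deg G x)%:R) <=
    lam * (\sum_x (deg G x)%:R * g x ^+ 2) * (\sum_x (deg G x)%:R) +
    (1 - lam) * (\sum_x (deg G x)%:R * g x) ^+ 2.
Proof.
move=> dpos Glam lam1.
have [/card0_eq T0 | /card_gt0P[x0 _]] := posnP #|T|.
  have none : (xpredT : pred T) =1 xpred0 by move=> x; have := T0 x.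
  by rewrite !(big_pred0 _ _ _ _ none) !(mulr0, expr0n) addr0.
pose dg x : R := (deg G x)%:R.
have dg0 x : 0 < dg x by rewrite ltr0n.
pose A := norm_adj R G.
pose e : 'rV[R]_#|T| := \row_i Num.sqrt (dg (enum_val i)).
pose v : 'rV[R]_#|T| := \row_i (Num.sqrt (dg (enum_val i)) * g (enum_val i)).
have sq x : Num.sqrt (dg x) * Num.sqrt (dg x) = dg x.
  by rewrite -expr2 sqr_sqrtr // ltW.
have sq0 x : Num.sqrt (dg x) != 0 by rewrite gt_eqF // sqrtr_gt0.
have sym : A^T = A.
  by apply/matrixP => i j; rewrite !mxE mult_sym [X in Num.sqrt X]mulrC.
have AE i j : A i j = (G (enum_val i) (enum_val j))%:R /
    (Num.sqrt (dg (enum_val i)) * Num.sqrt (dg (enum_val j))).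
  by rewrite mxE sqrtrM // ler0n.
have eA : e *m A = e.
  apply/rowP => j; rewrite !mxE.
  pose h x : R := (G x (enum_val j))%:R / Num.sqrt (dg (enum_val j)).
  rewrite (eq_bigr (fun i => h (enum_val i))) => [|i _]; last first.
    by rewrite AE !mxE /h; field; rewrite !sq0.
  rewrite -(big_enum_val h) /= -mulr_suml -natr_sum.
  rewrite (eq_bigr (G (enum_val j))) => [|x _]; last by rewrite mult_sym.
  by rewrite -/(deg _ _) -/(dg _) -[X in X / _]sq mulfK.
have e0 : e != 0.
  apply/eqP => /rowP/(_ (enum_rank x0)); rewrite !mxE enum_rankK.
  by apply/eqP.
have := second_eigenvalue_form v sym eA e0 lam1
  (le_trans (spectrum_second_le_lambda R G) Glam).
have sumE (h : T -> R) : \sum_(i < #|T|) h (enum_val i) = \sum_x h x.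
  by rewrite -(big_enum_val h).
have -> : (e *m e^T) 0 0 = \sum_x dg x.
  by rewrite mxE -sumE; apply: eq_bigr => i _; rewrite !mxE sq.
have -> : (v *m v^T) 0 0 = \sum_x dg x * g x ^+ 2.
  by rewrite mxE -sumE; apply: eq_bigr => i _; rewrite !mxE mulrACA sq expr2.
have -> : (v *m e^T) 0 0 = \sum_x dg x * g x.
  by rewrite mxE -sumE; apply: eq_bigr => i _; rewrite !mxE mulrAC sq.
suff -> : (v *m A *m v^T) 0 0 = \sum_x \sum_y (G x y)%:R * (g x * g y) by [].
rewrite exchange_big mxE -sumE; apply: eq_bigr => j _ /=.
rewrite mxE -sumE mulr_suml; apply: eq_bigr => i _.
by rewrite AE !mxE; field; rewrite !sq0.
Qed.

(** Cauchy-Schwarz on [U] bounds the last term of [mixing_form] by [mu] times the total volume times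
    the weighted square sum of [g]; the volume then cancels. *)
Lemma small_support_form (R : realType) (T : finType) (G : multigraph T)
    (U : pred T) (g : T -> R) (lam mu : R) :
  (forall x, 0 < deg G x)%N -> lambda R G <= lam -> lam < 1 ->
  (forall x, ~~ U x -> g x = 0) ->
  \sum_(x | U x) (deg G x)%:R <= mu * \sum_x (deg G x)%:R :> R ->
  \sum_x \sum_y (G x y)%:R * (g x * g y) <=
    (lam + (1 - lam) * mu) * \sum_x (deg G x)%:R * g x ^+ 2.
Proof.
move=> dpos Glam lam1 gU volU.
have [/card0_eq T0 | /card_gt0P[x0 _]] := posnP #|T|.
  have none : (xpredT : pred T) =1 xpred0 by move=> x; have := T0 x.
  by rewrite !(big_pred0 _ _ _ _ none) !(mulr0, expr0n).
have vol0 : 0 < \sum_x (deg G x)%:R :> R.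
  rewrite (bigD1 x0) //= ltr_pwDl ?ltr0n // sumr_ge0 // => y _.
have supp (h : T -> R) : (forall x, ~~ U x -> h x = 0) ->
    \sum_x h x = \sum_(x | U x) h x.
  move=> h0; rewrite [RHS]big_mkcond /=; apply: eq_bigr => x _.
  by case: ifP => // /negbT/h0.
rewrite -(ler_pM2r vol0) (le_trans (mixing_form g dpos Glam lam1)) //.
rewrite [X in _ <= X * _]mulrDl [leRHS]mulrDl lerD2l -!mulrA.
rewrite ler_wpM2l ?subr_ge0 ?(ltW lam1) //.
rewrite supp => [|x /gU ->]; last by rewrite mulr0.
rewrite [X in _ * (X * _)]supp => [|x /gU ->]; last by rewrite expr0n mulr0.
apply: le_trans (weighted_Cauchy_Schwarz _ _ _) _ => [x|]; first exact: ler0n.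
rewrite [X in mu * X]mulrC mulrA ler_wpM2r //.
by apply: sumr_ge0 => x _; rewrite mulr_ge0 ?sqr_ge0.
Qed.

(* On the support the degrees of [induced G U] lie between [d / 2] and [d], so
   a set of at most half of the vertices carries at most 2/3 of the volume. *)
Lemma minority_form (R : realType) (T : finType) (G : multigraph T) (d : nat)
    (U W : {set T}) (f : T -> R) :
  (0 < d)%N -> (forall x, deg G x = d) ->
  (forall x, x \in U -> d <= 2 * \sum_(y in U) G x y)%N ->
  lambda R (induced G U) <= 1 / 33 ->
  W \subset U -> (#|W| <= #|U :\: W|)%N -> (forall x, x \notin W -> f x = 0) ->
  \sum_x \sum_y (G x y)%:R * (f x * f y) <=
    67 / 99 * \sum_x \sum_(y in U) (G x y)%:R * f x ^+ 2.
Proof.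
move=> d0 degG degU lamU WU Wle fW.
have degE (x : {x | x \in U}) : deg (induced G U) x =
    (\sum_(y in U) G (val x) y)%N.
  by rewrite /deg /= (big_sub (mem U)).
have dpos (x : {x | x \in U}) : (0 < deg (induced G U) x)%N.
  have := degU _ (valP x); rewrite degE.
  case: (\sum_(y in U) _)%N => //; by rewrite muln0 leqNgt d0.
have fU x : x \notin U -> f x = 0.
  by move=> xU; apply: fW; apply: contra xU; apply: (subsetP WU).
have volW : \sum_(x : {x | x \in U} | val x \in W) (deg (induced G U) x)%:R <=
    2 / 3 * \sum_x (deg (induced G U) x)%:R :> R.
  rewrite [X in _ * X](bigID (fun x => val x \in W)) /=.
  set a := \sum_(_ | _) _; set b := \sum_(_ | _) _.
  have ab : a <= 2 * b.
    rewrite /a /b -!natr_sum -natrM ler_nat.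
    rewrite (eq_bigr _ (fun x _ => degE x)).
    rewrite [in leqRHS](eq_bigr _ (fun x _ => degE x)).
    rewrite -(big_sub_cond (mem U) (mem W) (fun x => \sum_(y in U) G x y)%N).
    rewrite -(big_sub_cond (mem U) [predC W] (fun x => \sum_(y in U) G x y)%N).
    (* [#|W| * d] separates the two sides: it bounds the volume of [W] from above, and it is at most
       twice the volume of [U :\: W], which has at least as many vertices, all of degree at least
       [d / 2]. *)
    apply: (@leq_trans (\sum_(x in W) d)%N).
      rewrite (eq_bigl (mem W)) => [|x]; last first.
        by apply: andb_idl => xW; apply: (subsetP WU).
      apply: leq_sum => x _; rewrite -(degG x) /deg [leqRHS](bigID (mem U)) /=.
      exact: leq_addr.
    rewrite sum_nat_const (leq_trans (leq_mul Wle (leqnn d))) //.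
    rewrite -sum_nat_const big_distrr /=.
    rewrite [leqRHS](eq_bigl (mem (U :\: W))) => [|x]; last first.
      by rewrite !inE andbC.
    by apply: leq_sum => x; rewrite inE => /andP[_ /degU].
  lra.
have sumU (h : T -> R) : (forall x, x \notin U -> h x = 0) ->
    \sum_x h x = \sum_(x : {x | x \in U}) h (val x).
  move=> h0; rewrite -(big_sub (mem U)) [RHS]big_mkcond.
  by apply: eq_bigr => x _; case: ifP => // /negbT/h0.
rewrite sumU => [|x xU]; last by rewrite big1 // => y _; rewrite fU // mul0r mulr0.
rewrite [X in _ * X]sumU => [|x xU]; last first.
  by rewrite big1 // => y _; rewrite fU // expr0n mulr0.
have := @small_support_form _ _ _ (fun x => val x \in W) (f \o val) _ _ dpos lamU _ _ volW.
(* The constant is [lam + (1 - lam) * mu] at [lam = 1 / 33] and [mu = 2 / 3]. *)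
have -> : 1 / 33 + (1 - 1 / 33) * (2 / 3) = 67 / 99 :> R by field.
have lt1 : 1 / 33 < 1 :> R by lra.
move=> /(_ lt1 (fun x => fW (val x))) form.
apply: le_trans (le_trans form _).
  rewrite le_eqVlt; apply/orP; left; apply/eqP; apply: eq_bigr => x _.
  by rewrite sumU => // y yU; rewrite (fU y) // !mulr0.
rewrite le_eqVlt; apply/orP; left; apply/eqP; congr (_ * _); apply: eq_bigr => x _.
by rewrite degE natr_sum mulr_suml.
Qed.

(** * The inequality for a single edge *)

(* [a] and [b] stand for the square roots of the fractions of the two error
   sets that lie in their intersection. *)
Lemma pair_bound (R : realFieldType) (a b : R) :
  0 <= a <= 1 -> 0 <= b <= 1 ->
  67 / 99 * (a ^+ 2 + b ^+ 2) - 2 * (a * b) <= 67 / 99.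
Proof.
move=> /andP[a0 a1] /andP[b0 b1].
by have [ab|ab] := lerP a b; nra.
Qed.

(** The form is convex in each variable, so its maximum over the square is attained at a corner. The
    largest corner value is [-61/396], at [(1/2, 1)] and [(1, 1/2)], just below [-3/20]. *)
Lemma pair_bound_typical (R : realFieldType) (a b : R) :
  1 / 2 <= a <= 1 -> 1 / 2 <= b <= 1 ->
  67 / 99 * (a ^+ 2 + b ^+ 2) - 2 * (a * b) <= - (3 / 20).
Proof.
move=> /andP[a0 a1] /andP[b0 b1].
have := mulr_ge0 (_ : 0 <= a - 1 / 2) (_ : 0 <= 1 - a).
have := mulr_ge0 (_ : 0 <= b - 1 / 2) (_ : 0 <= 1 - b).
have := mulr_ge0 (_ : 0 <= a - 1 / 2) (_ : 0 <= b - 1 / 2).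
have := mulr_ge0 (_ : 0 <= a - 1 / 2) (_ : 0 <= 1 - b).
have := mulr_ge0 (_ : 0 <= 1 - a) (_ : 0 <= b - 1 / 2).
have := mulr_ge0 (_ : 0 <= 1 - a) (_ : 0 <= 1 - b).
rewrite !subr_ge0 => /(_ a1 b1) ? /(_ a1 b0) ? /(_ a0 b1) ? /(_ a0 b0) ?.
move=> /(_ b0 b1) ? /(_ a0 a1) ?.
lra.
Qed.

(** [A] and [B] are the error sets of the ends [A'] and [B'] of an edge, and [r] says that it is
    rejected. An end is thin if it has at least 4 errors and the other end captures at most a
    quarter of them. A rejected edge costs at most [2 * c], an accepted one with a thin end at most
    [c]; an accepted edge without thin ends gains [b] unless the overlap is empty, when the left
    side vanishes. *)
Lemma edge_bound (R : realType) (I : finType) (A B A' B' : {set I}) (r : bool)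
    (c := 67 / 99 : R) (b := 3 / 20 : R) :
  A \subset A' -> B \subset B' -> (~~ r -> A :&: B' = B :&: A') ->
  c * (#|A :&: B'|%:R / #|A|%:R + #|B :&: A'|%:R / #|B|%:R) -
    2 * (#|A :&: B|%:R / (Num.sqrt #|A|%:R * Num.sqrt #|B|%:R)) <=
  (c + b) * (((4 <= #|A|) && (#|B' :&: A| * 4 <= #|A|))%N%:R +
             ((4 <= #|B|) && (#|A' :&: B| * 4 <= #|B|))%N%:R) +
  (2 * c + b) * r%:R - b * (A :&: B' != set0)%:R.
Proof.
have frac_ge0 (X Y : {set I}) : 0 <= #|X|%:R / #|Y|%:R :> R.
  by rewrite divr_ge0 ?ler0n.
have frac_le1 (X Y : {set I}) : #|X :&: Y|%:R / #|X|%:R <= 1 :> R.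
  have [->|X0] := eqVneq #|X| 0%N; first by rewrite invr0 mulr0.
  by rewrite ler_pdivrMr ?ltr0n ?lt0n // mul1r ler_nat subset_leq_card ?subsetIl.
move=> AA' BB' consistent.
set t := (_ && _); set t' := (_ && _); set x := (_ != _).
have b0 : 0 <= b by rewrite /b; lra.
have c0 : 0 <= c by rewrite /c; lra.
have t0 : 0 <= (c + b) * (t%:R + t'%:R) by rewrite mulr_ge0 ?addr_ge0.
have x1 : b * x%:R <= b by rewrite ler_piMr // lern1 leq_b1.
case: r consistent => [_|/(_ isT) AB].
  have := frac_le1 A B'; have := frac_le1 B A'.
  have : 0 <= #|A :&: B|%:R / (Num.sqrt #|A|%:R * Num.sqrt #|B|%:R) :> R.
    by rewrite divr_ge0 // mulr_ge0 ?sqrtr_ge0.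
  rewrite mulr1.
  set u := _ / _; set v := _ / _; set w := _ / _ => u0 v1 w1.
  have : c * (w + v) <= c * 2 by rewrite ler_wpM2l //; lra.
  lra.
(* On an accepted edge the common set lies in both [A] and [B], so it is [A :&: B]. *)
have IE : A :&: B = A :&: B'.
  apply/eqP; rewrite eqEsubset setIS //= subsetI subsetIl /= AB subsetIl //.
rewrite -AB IE mulr0 addr0.
have [k0|] := eqVneq #|A :&: B'| 0%N.
  have x0 : x = false by rewrite /x -cards_eq0 k0.
  by rewrite k0 x0 !mul0r !mulr0 addr0 mulr0 !subr0.
rewrite -lt0n => k0.
have kA : (#|A :&: B'| <= #|A|)%N by rewrite subset_leq_card ?subsetIl.
have kB : (#|A :&: B'| <= #|B|)%N by rewrite AB subset_leq_card ?subsetIl.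
pose a : R := Num.sqrt (#|A :&: B'|%:R / #|A|%:R).
pose a' : R := Num.sqrt (#|A :&: B'|%:R / #|B|%:R).
have aE : #|A :&: B'|%:R / #|A|%:R = a ^+ 2 by rewrite sqr_sqrtr.
have a'E : #|A :&: B'|%:R / #|B|%:R = a' ^+ 2 by rewrite sqr_sqrtr.
have -> : #|A :&: B'|%:R / (Num.sqrt #|A|%:R * Num.sqrt #|B|%:R) = a * a'.
  rewrite /a /a' !sqrtrM ?ler0n // !sqrtrV ?ler0n // mulrACA -expr2.
  by rewrite sqr_sqrtr ?ler0n // invfM.
rewrite aE a'E.
have a1 : 0 <= a <= 1.
  by rewrite sqrtr_ge0 -sqrtr1 ler_wsqrtr // frac_le1.
have a'1 : 0 <= a' <= 1.
  by rewrite sqrtr_ge0 -sqrtr1 ler_wsqrtr // AB frac_le1.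
have := pair_bound a1 a'1; rewrite -/c => pb.
have b1 : (c + b) * 1 = c + b by rewrite mulr1.
case tE: t t0; first by rewrite mulrDr b1; case: (t') => /=; lra.
case t'E: t'; first by rewrite mulrDr b1 => _ /=; lra.
move=> _; rewrite addr0 mulr0 sub0r.
have half m : (0 < m)%N -> (m < #|A :&: B'| * 4)%N ->
    1 / 2 <= Num.sqrt (#|A :&: B'|%:R / m%:R) :> R.
  move=> m0 mk; have -> : 1 / 2 = Num.sqrt ((1 / 2) ^+ 2) :> R.
    by rewrite sqrtr_sqr ger0_norm //; lra.
  rewrite ler_wsqrtr // ler_pdivlMr ?ltr0n //.
  by move: mk; rewrite -(ltr_nat R) natrM; lra.
have aa : 1 / 2 <= a <= 1.
  case/andP: a1 => _ ->; rewrite andbT half ?(leq_trans k0) //.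
  (* An end that is not thin either has more than a quarter of its errors captured, or has fewer
     than 4 errors, and then a single captured one is more than a quarter. *)
  move/negbT: tE; rewrite negb_and -!ltnNge setIC => /orP[] //.
  by move/leq_trans; apply; rewrite -[X in (X <= _)%N]mul1n leq_mul2r k0 orbT.
have aa' : 1 / 2 <= a' <= 1.
  case/andP: a'1 => _ ->; rewrite andbT half ?(leq_trans k0) //.
  move/negbT: t'E; rewrite negb_and -!ltnNge setIC -AB => /orP[] //.
  by move/leq_trans; apply; rewrite -[X in (X <= _)%N]mul1n leq_mul2r k0 orbT.
have := pair_bound_typical aa aa'; rewrite -/b -/c.
lra.
Qed.

(** * Summation over coordinates and over edges *)

(** After exchanging sums, both sides split over the coordinates [i], and [minority_form] applies to
    each [f i] on the vertices with [i \in supp S]. Where [D S] is empty, [f i S] is 0. *)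
Lemma coordinate_sum_form (R : realType) (X I : finType) (G : multigraph X)
    (supp D : X -> {set I}) (d : nat) :
  (0 < d)%N -> (forall S, deg G S = d) -> (forall S, D S \subset supp S) ->
  (forall i S, i \in supp S -> (d <= 2 * \sum_(S' | i \in supp S') G S S')%N) ->
  (forall i, lambda R (induced G [set S | i \in supp S]) <= 1 / 33) ->
  (forall i, #|[set S | i \in D S]| <=
     #|[set S | i \in supp S] :\: [set S | i \in D S]|)%N ->
  \sum_S \sum_S' (G S S')%:R *
      (#|D S :&: D S'|%:R / (Num.sqrt #|D S|%:R * Num.sqrt #|D S'|%:R)) <=
    67 / 99 * \sum_S \sum_S' (G S S')%:R *
      (#|D S :&: supp S'|%:R / #|D S|%:R) :> R.
Proof.
move=> d0 degG Dsupp degi lami Wle.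
pose f i S : R := (i \in D S)%:R / Num.sqrt #|D S|%:R.
have cardE (A : {set I}) : #|A|%:R = \sum_i (i \in A)%:R :> R.
  by rewrite -sum1_card natr_sum big_mkcond; apply: eq_bigr => i _; case: (i \in A).
have -> : \sum_S \sum_S' (G S S')%:R *
      (#|D S :&: D S'|%:R / (Num.sqrt #|D S|%:R * Num.sqrt #|D S'|%:R)) =
    \sum_i \sum_S \sum_S' (G S S')%:R * (f i S * f i S') :> R.
  rewrite [RHS]exchange_big; apply: eq_bigr => S _ /=.
  rewrite [RHS]exchange_big; apply: eq_bigr => S' _ /=.
  rewrite -mulr_sumr cardE mulr_suml; congr (_ * _); apply: eq_bigr => i _.
  by rewrite inE /f -mulnb natrM mulrACA invfM.
have -> : \sum_S \sum_S' (G S S')%:R * (#|D S :&: supp S'|%:R / #|D S|%:R) =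
    \sum_i \sum_S \sum_(S' in [set S | i \in supp S]) (G S S')%:R * f i S ^+ 2 :> R.
  rewrite [RHS]exchange_big; apply: eq_bigr => S _ /=.
  transitivity (\sum_i \sum_S' (G S S')%:R * ((i \in supp S')%:R * f i S ^+ 2)).
    rewrite [RHS]exchange_big; apply: eq_bigr => S' _ /=.
    rewrite -mulr_sumr cardE mulr_suml; congr (_ * _); apply: eq_bigr => i _.
    rewrite inE /f expr_div_n sqr_sqrtr // -natrX mulrA -natrM.
    by case: (i \in D S); case: (i \in supp S').
  apply: eq_bigr => i _; rewrite [RHS]big_mkcond; apply: eq_bigr => S' _.
  by rewrite inE; case: ifP => _; rewrite ?mul1r // mul0r mulr0.
rewrite mulr_sumr; apply: ler_sum => i _.
apply: (@minority_form _ _ _ d _ [set S | i \in D S]) => //.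
- move=> S; rewrite inE => /degi; congr (_ <= 2 * _)%N.
  by apply: eq_bigl => S'; rewrite inE.
- by apply/subsetP => S; rewrite !inE; apply: (subsetP (Dsupp S)).
- by move=> S; rewrite inE /f => /negbTE ->; rewrite mul0r.
Qed.

(** Summing [edge_bound] against [coordinate_sum_form] relates three edge counts: thin, rejected,
    and meeting [D S]. The last is large and the first small, so the rejected edges make up the
    difference. *)
Lemma rejection_bound (R : realType) (X I : finType) (G : multigraph X)
    (supp D : X -> {set I}) (rej : rel X) (d : nat) :
  (0 < d)%N -> (forall S, deg G S = d) -> (forall S, D S \subset supp S) ->
  (forall S S', ~~ rej S S' -> D S :&: supp S' = D S' :&: supp S) ->
  (forall i S, i \in supp S -> (d <= 2 * \sum_(S' | i \in supp S') G S S')%N) ->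
  (forall i, lambda R (induced G [set S | i \in supp S]) <= 1 / 33) ->
  (forall i, #|[set S | i \in D S]| <=
     #|[set S | i \in supp S] :\: [set S | i \in D S]|)%N ->
  (forall S, 4 <= #|D S| ->
    33 * \sum_(S' | #|supp S' :&: D S| * 4 <= #|D S|) G S S' <= d)%N ->
  (d * #|[set S | D S != set0]|)%:R <=
    100 * (\sum_S \sum_(S' | rej S S') G S S')%:R :> R.
Proof.
move=> d0 degG Dsupp consistent degi lami Wle thin.
have form := coordinate_sum_form d0 degG Dsupp degi lami Wle.
pose E (h : X -> X -> R) := \sum_S \sum_S' (G S S')%:R * h S S'.
pose B := [set S | D S != set0].
have ED h k : E (fun S S' => h S S' + k S S') = E h + E k.
  rewrite /E -big_split; apply: eq_bigr => S _; rewrite -big_split.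
  by apply: eq_bigr => S' _; rewrite mulrDr.
have EZ a h : E (fun S S' => a * h S S') = a * E h.
  rewrite /E mulr_sumr; apply: eq_bigr => S _; rewrite mulr_sumr.
  by apply: eq_bigr => S' _; rewrite mulrCA.
have Eswap h : E (fun S S' => h S' S) = E h.
  rewrite /E exchange_big; apply: eq_bigr => S _; apply: eq_bigr => S' _.
  by rewrite mult_sym.
have Enat (p : rel X) :
    E (fun S S' => (p S S')%:R) = (\sum_S \sum_(S' | p S S') G S S')%N%:R.
  rewrite /E natr_sum; apply: eq_bigr => S _; rewrite natr_sum [RHS]big_mkcond.
  by apply: eq_bigr => S' _; case: (p S S'); rewrite ?mulr1 ?mulr0.
pose al S S' : R := #|D S :&: supp S'|%:R / #|D S|%:R.
pose om S S' : R := #|D S :&: D S'|%:R / (Num.sqrt #|D S|%:R * Num.sqrt #|D S'|%:R).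
pose t S S' := (4 <= #|D S|)%N && (#|supp S' :&: D S| * 4 <= #|D S|)%N.
pose x S S' := D S :&: supp S' != set0.
have {form} : 0 <= 2 * (67 / 99 * E al - E om) by rewrite mulr_ge0 // subr_ge0.
have -> : 2 * (67 / 99 * E al - E om) =
    E (fun S S' => 67 / 99 * (al S S' + al S' S) + (-2) * om S S').
  by rewrite ED !EZ ED (Eswap al); ring.
have edge : E (fun S S' => 67 / 99 * (al S S' + al S' S) + (-2) * om S S') <=
    E (fun S S' => (67 / 99 + 3 / 20) * ((t S S')%:R + (t S' S)%:R) +
      ((2 * (67 / 99) + 3 / 20) * (rej S S')%:R + (- (3 / 20)) * (x S S')%:R)).
  apply: ler_sum => S _; apply: ler_sum => S' _; rewrite ler_wpM2l //.
  rewrite !mulNr addrA.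
  exact: edge_bound (Dsupp S) (Dsupp S') (consistent S S').
move=> /le_trans/(_ edge); rewrite ED EZ ED (Eswap (fun S S' => (t S S')%:R)).
rewrite ED !EZ !Enat -/B.
(* For a fixed [i] in [D S], half of the edges at [S] lead to some [S'] containing [i], and these
   meet [D S]. *)
have hitB : (d * #|B| <= 2 * \sum_S \sum_(S' | x S S') G S S')%N.
  rewrite mulnC -sum_nat_const big_distrr [leqRHS](bigID (mem B)) /=.
  apply: leq_trans (leq_addr _ _); apply: leq_sum => S; rewrite inE => /set0Pn[i iD].
  apply: leq_trans (degi i S (subsetP (Dsupp S) i iD)) _.
  rewrite leq_mul2l /= big_mkcond [leqRHS]big_mkcond; apply: leq_sum => S' _.
  case: ifP => // iS'; suff -> : x S S' by [].
  by apply/set0Pn; exists i; rewrite inE iD iS'.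
have thinB : (33 * \sum_S \sum_(S' | t S S') G S S' <= d * #|B|)%N.
  rewrite [leqRHS]mulnC -sum_nat_const big_distrr [leqRHS]big_mkcond /=.
  apply: leq_sum => S _; rewrite inE.
  have [D4|D4] := leqP 4 #|D S|.
    have -> : D S != set0 by rewrite -card_gt0 (leq_trans _ D4).
    apply: leq_trans (thin S D4); rewrite leq_mul2l /=.
    rewrite (eq_bigl (fun S' => #|supp S' :&: D S| * 4 <= #|D S|)%N) // => S'.
    by rewrite /t D4.
  by rewrite big_pred0 ?muln0 // => S'; rewrite /t leqNgt D4.
move: hitB thinB; rewrite -!(ler_nat R) !natrM.
set u := (\sum_S _)%:R; set v := (\sum_S _)%:R; set w := (\sum_S _)%:R.
(* In units of [d * #|B|], the edges meeting [D S] gain at least [3/40], and the thin ones, counted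
   from both ends, cost at most [2 * (67/99 + 3/20) / 33], about 0.050. The remaining 0.0249 is paid
   by rejected edges at about 1.504 each; the quotient is just over 60, so 100 suffices. *)
have : 0 <= w by []. lra.
Qed.

(** * Error sets and the majority vote *)

(** A subset of ['I_n] rather than of the domain of [F S], so that error sets of different vertices
    can be intersected. *)
Definition errors (n : nat) (V : {set {set 'I_n}}) (F : assignment V)
    (a : {ffun 'I_n -> bool}) (S : vertex V) : {set 'I_n} :=
  [set i | [exists x : {j : 'I_n | j \in val S},
              (val x == i) && (F S x != a i)]].

Lemma mem_errors (n : nat) (V : {set {set 'I_n}}) (F : assignment V)
    (a : {ffun 'I_n -> bool}) (S : vertex V)
    (x : {j | j \in val S}) :
  (val x \in errors F a S) = (F S x != a (val x)).
Proof.
rewrite inE; apply/existsP/idP => [[y /andP[/eqP/val_inj -> //]] | Fx].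
by exists x; rewrite eqxx.
Qed.

Lemma errors_sub (n : nat) (V : {set {set 'I_n}}) (F : assignment V)
    (a : {ffun 'I_n -> bool}) (S : vertex V) :
  errors F a S \subset val S.
Proof.
apply/subsetP => i; rewrite inE => /existsP[x /andP[/eqP <- _]].
exact: (valP x).
Qed.

Lemma errors_neq0 (n : nat) (V : {set {set 'I_n}}) (F : assignment V)
    (a : {ffun 'I_n -> bool}) (S : vertex V) :
  (F S != DP V a S) = (errors F a S != set0).
Proof.
apply/idP/idP => [|/set0Pn[i iD]].
  apply: contra => /eqP D0; apply/eqP/ffunP => x; rewrite ffunE.
  by apply/eqP/negPn; rewrite -mem_errors D0 inE.
have iS := subsetP (errors_sub F a S) i iD.
apply: contraTneq iD => FS; rewrite -[ i ]/(val (Sub i iS : {j | j \in val S})).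
by rewrite mem_errors FS ffunE eqxx.
Qed.

(** A coordinate shared by [S] and [S'] gets the same value from both, so it is an error at both or
    at neither. *)
Lemma errors_agree (n : nat) (V : {set {set 'I_n}}) (F : assignment V)
    (a : {ffun 'I_n -> bool}) (S S' : vertex V) : agree F S S' ->
  errors F a S :&: val S' = errors F a S' :&: val S.
Proof.
move=> /forallP agr; apply/setP => i; rewrite !in_setI.
have [iS|iS] := boolP (i \in val S); last first.
  rewrite andbF; apply/negbTE; apply: contra iS => /andP[iD _].
  by apply: (subsetP (errors_sub F a S)).
have [iS'|iS'] := boolP (i \in val S'); last first.
  rewrite andbF; apply/esym/negbTE; apply: contra iS' => /andP[iD _].
  by apply: (subsetP (errors_sub F a S')).
rewrite !andbT -[ i ]/(val (Sub i iS : {j | j \in val S})) mem_errors.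
rewrite [X in X \in errors F a S']/(val (Sub i iS' : {j | j \in val S'})) mem_errors.
by have /forallP/(_ (Sub i iS'))/implyP/(_ (eqxx _))/eqP -> := agr (Sub i iS).
Qed.

(** Errors at [i] are votes for the losing value, and votes for the winning value are not errors. In
    a tie the two counts are equal, so any rule [tie] will do. *)
Lemma majority_errors (n : nat) (V : {set {set 'I_n}}) (F : assignment V)
    (tie : 'I_n -> bool) (i : 'I_n) :
  (#|[set S | i \in errors F (majority tie F) S]| <=
   #|[set S : vertex V | i \in val S] :\:
      [set S | i \in errors F (majority tie F) S]|)%N.
Proof.
set a := majority tie F.
have votes_le : (votes F i (~~ a i) <= votes F i (a i))%N.
  by rewrite /a ffunE; case: ltngtP => [/ltnW|/ltnW|eqv] //; case: (tie i); rewrite /= eqv.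
apply: leq_trans (leq_trans votes_le _); apply: subset_leq_card; apply/subsetP => S.
  rewrite !inE => /existsP[x /andP[/eqP xi Fx]]; apply/existsP; exists x.
  by rewrite xi eqxx; move: Fx; case: (F S x); case: (a i).
rewrite !inE => /existsP[x /andP[/eqP xi /eqP Fx]].
rewrite -xi (valP x) andbT; apply/existsP => -[y /andP[/eqP/val_inj ->]].
by rewrite Fx xi eqxx.
Qed.

(** * From rejected edges to the distance from [dec] *)

Lemma dist_le1 (R : realType) (n : nat) (V : {set {set 'I_n}})
    (F H : assignment V) : dist R F H <= 1.
Proof.
rewrite /dist; have [->|V0] := eqVneq #|V| 0%N; first by rewrite invr0 mulr0.
rewrite ler_pdivrMr ?ltr0n ?lt0n // mul1r ler_nat -[leqRHS]card_sig.
exact: max_card.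
Qed.

Theorem theorem4p2 (R : realType) :
  exists2 C : R, 0 < C &
    forall (n : nat) (rho lam : R), 1 / 2 <= rho -> lam <= 1 / 33 ->
    forall (V : {set {set 'I_n}}) (G : multigraph (vertex V)), regular G ->
    forall (eps : R), 0 <= eps ->
    forall (F : assignment V) (tie : 'I_n -> bool),
      coordinate_expander lam rho G ->
      pass_prob R G F = 1 - eps ->
      dist R F (dec tie F) <= C * eps.
Proof.
exists 100; first by [].
move=> n rho lam rho_ge lam_le V G [d degG] eps eps0 F tie [[_ lamG] nbrs thin] pass.
have volE : (\sum_S deg G S = #|V| * d)%N.
  by rewrite (eq_bigr _ (fun S _ => degG S)) sum_nat_const card_sig.
(* Without edges the pass probability is a division by zero, hence 0; then [eps = 1], and the
   trivial bound on the distance is enough. *)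
have [vol0|] := posnP (#|V| * d)%N.
  move: pass; rewrite /pass_prob volE vol0 invr0 mulr0 => pass.
  have -> : eps = 1 by lra.
  by apply: le_trans (dist_le1 _ _ _) _; rewrite mulr1 ler1n.
rewrite muln_gt0 => /andP[V0 d0].
pose a := majority tie F; pose D := errors F a.
have bound := @rejection_bound R (vertex V) _ G (fun S => val S) D
  (fun S S' => ~~ agree F S S') d d0 degG (errors_sub F a) _ _ _
  (majority_errors F tie) _.
(* Accepted and rejected edges together have weight [#|V| * d], so the rejected ones have a share
   [eps] of it. *)
have rejE : (\sum_S \sum_(S' | ~~ agree F S S') G S S')%N%:R =
    eps * (#|V|%:R * d%:R) :> R.
  have : (\sum_S \sum_(S' | agree F S S') G S S' +
      \sum_S \sum_(S' | ~~ agree F S S') G S S' = #|V| * d)%N.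
    rewrite -volE -big_split; apply: eq_bigr => S _.
    by rewrite /deg [RHS](bigID (agree F S)).
  have vol0 : #|V|%:R * d%:R != 0 :> R by rewrite mulf_neq0 // pnatr_eq0 -lt0n.
  move=> /(congr1 (fun k => k%:R : R)); rewrite natrD natrM.
  move: pass; rewrite /pass_prob volE natrM => /(canRL (divfK vol0)) ->.
  by move=> /(canRL (addKr _)) ->; ring.
rewrite /dist; have -> : [set S | F S != dec tie F S] = [set S | D S != set0].
  by apply/setP => S; rewrite !inE errors_neq0.
rewrite ler_pdivrMr ?ltr0n // -(@ler_pM2l _ d%:R) ?ltr0n //.
rewrite -natrM (le_trans (bound _ _ _ _)) //.
- by move=> S S'; rewrite negbK; exact: errors_agree.
- move=> i S iS; have := nbrs i S; rewrite inE => /(_ iS).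
  rewrite /nbr_prob degG ler_pdivlMr ?ltr0n // => le_nbr.
  rewrite -(ler_nat R) natrM.
  have -> : (\sum_(S' : vertex V | i \in val S') G S S' =
      \sum_(S' | S' \in star V i) G S S')%N.
    by apply: eq_bigl => S'; rewrite inE.
  have : 1 / 2 * d%:R <= rho * d%:R by rewrite ler_wpM2r.
  lra.
- by move=> i; apply: ltW; apply: lt_le_trans (lamG i) lam_le.
(* Since [rho >= 1/2], 4 errors reach the threshold [2 / rho], and a quarter of [D S] is at most
   [rho * #|D S| / 2]; so condition (3) with [T = D S] covers every thin edge. *)
- move=> S D4; have rho0 : 0 < rho by lra.
  have := thin S (D S) (errors_sub F a S).
  rewrite ler_pdivrMr // => /(_ _)/wrap[].
    have : 4 <= #|D S|%:R :> R by rewrite ler_nat.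
    by nra.
  rewrite /nbr_prob degG ler_pdivrMr ?ltr0n // => thinS.
  rewrite -(ler_nat R) natrM.
  have : (\sum_(S' : vertex V | #|val S' :&: D S| * 4 <= #|D S|) G S S')%N%:R <=
      (\sum_(S' : vertex V | (#|val S' :&: D S|%:R <= rho * #|D S|%:R / 2)%R)
         G S S')%N%:R :> R.
    rewrite ler_nat big_mkcond [leqRHS]big_mkcond; apply: leq_sum => S' _.
    case: ifP => //; rewrite -(ler_nat R) natrM => le4.
    suff -> : #|val S' :&: D S|%:R <= rho * #|D S|%:R / 2 by [].
    have : 1 / 2 * #|D S|%:R <= rho * #|D S|%:R by rewrite ler_wpM2r.
    lra.
  have : lam * d%:R <= 1 / 33 * d%:R by rewrite ler_wpM2r.
  lra.
by rewrite rejE; lra.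
Qed.
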